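(* Let $p$ be a prime. If $G$ is a finite $(p+2)$-centralizer $p$-group with center $Z(G)$, then the spectrum of the commuting graph $\Gamma_G$ of $G$ is $$\operatorname{Spec}(\Gamma_G) = \{(-1)^{(p^2 - 1)|Z(G)| - p - 1},\ ((p - 1)|Z(G)| - 1)^{p + 1}\}.$$ Hence, $G$ is commuting integral.
   Context: For an element $x$ of a group $G$, $C_G(x)=\{y\in G: xy=yx\}$ is its centralizer. Let $\operatorname{Cent}(G)=\{C_G(x): x\in G\}$ be the set of distinct element centralizers (including $G$ itself, the centralizer of central elements). $G$ is called an $n$-centralizer group if $|\operatorname{Cent}(G)|=n$. For a non-abelian group $G$ with center $Z(G)$, the commuting graph $\Gamma_G$ is the simple undirected graph with vertex set $G\setminus Z(G)$ in which two distinct vertices $x,y$ are adjacent if and only if $xy=yx$. The spectrum $\operatorname{Spec}(\mathcal{G})=\{\lambda_1^{k_1},\dots,\lambda_n^{k_n}\}$ of a finite graph $\mathcal{G}$ is the multiset of eigenvalues of its adjacency matrix, where $\lambda^{k}$ means that the eigenvalue $\lambda$ is listed with multiplicity $k$ (if the same value is listed more than once, the multiplicities add). A finite graph is integral if its spectrum contains only integers. A finite non-abelian group $G$ is called commuting integral if $\Gamma_G$ is integral. *)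

(* Defs.v *)
From mathcomp Require Import all_boot all_order all_algebra.
From mathcomp Require Import all_fingroup all_solvable all_field.

Set Implicit Arguments.
Unset Strict Implicit.
Unset Printing Implicit Defensive.

Import Order.TTheory GRing.Theory Num.Theory.
Local Open Scope ring_scope.

Definition Cent (gT : finGroupType) (G : {set gT}) : {set {set gT}} :=
  [set 'C_G[x]%g | x in G].

Definition n_centralizer (n : nat) (gT : finGroupType) (G : {set gT}) : Prop :=
  #|Cent G| = n.

(* A finite graph is given by its adjacency relation on the finType of its     *)
(* vertices.                                                                   *)

Definition adj_mx (T : finType) (e : rel T) : 'M[algC]_#|T| :=
  \matrix_(i, j) (e (enum_val i) (enum_val j))%:R.

(* The spectrum is the sequence of roots of the characteristic polynomial,     *)
(* with multiplicity. The order of this sequence is meaningless: spectra are   *)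
(* multisets, to be compared with perm_eq. Taking the eigenvalues in algC      *)
(* loses nothing, since the characteristic polynomial has integer coefficients.*)
Definition spectrum (T : finType) (e : rel T) : seq algC :=
  sval (closed_field_poly_normal (char_poly (adj_mx e))).

Definition integral_graph (T : finType) (e : rel T) : Prop :=
  {in spectrum e, forall a, a \is a Num.int}.

Definition noncentral (gT : finGroupType) (G : {set gT}) : finType :=
  {x : gT | x \in G :\: 'Z(G)%g}.

Definition commuting_graph (gT : finGroupType) (G : {set gT}) :
    rel (noncentral G) :=
  fun x y => (x != y) && (val x * val y == val y * val x)%g.

Definition commuting_integral (gT : finGroupType) (G : {set gT}) : Prop :=
  ~~ abelian G /\ integral_graph (@commuting_graph gT G).

Lemma spectrumP (T : finType) (e : rel T) :
  char_poly (adj_mx e) = \prod_(a <- spectrum e) ('X - a%:P).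
Proof.
rewrite /spectrum; case: closed_field_poly_normal => r /= {1}->.
by rewrite (monicP (char_poly_monic _)) scale1r.
Qed.

Lemma commuting_graph_sym (gT : finGroupType) (G : {set gT}) :
  symmetric (@commuting_graph gT G).
Proof. by move=> x y; rewrite /commuting_graph eq_sym (eq_sym (_ * _)%g). Qed.

Lemma commuting_graph_irr (gT : finGroupType) (G : {set gT}) :
  irreflexive (@commuting_graph gT G).
Proof. by move=> x; rewrite /commuting_graph eqxx. Qed.

(* Main.v *)
Require Import Defs.
From mathcomp Require Import all_boot all_order all_algebra.
From mathcomp Require Import all_fingroup all_solvable all_field.
From mathcomp Require Import zify ring.

Set Implicit Arguments.
Unset Strict Implicit.
Unset Printing Implicit Defensive.

Import Order.TTheory GRing.Theory Num.Theory.
Local Open Scope ring_scope.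

(** The group side rests on the fact that a finite group cannot be covered
    cheaply. The proper element centralizers cover a non-abelian group [G], and
    in a [p]-group they have index at least [p]; here there are [p + 1] of them.
    If subgroups [H_0, ..., H_p] of index at least [p] cover [G], then, since
    [H_i] meets [H_0] in at least the proportion [|H_0| / |G|] of its elements,
    [H_1, ..., H_p] can fill up [G :\: H_0] only if there is no waste at all:
    every member has index exactly [p] ([cover_index]), any two have an
    intersection of index [p ^ 2] ([cover_card_cap]), and two distinct members
    overlap only inside [H_0] ([cover_cap_sub]). As [H_0] is arbitrary, two
    distinct members meet in the intersection of all of them, which for
    centralizers is the center ([distinct_cent1_cap]). Hence
    [|G| = p ^ 2 * |'Z(G)|], every proper centralizer has order [p * |'Z(G)|],
    and, because [y] lies in the centralizers of both [x] and [y] when they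
    commute, noncentral elements commute exactly when they have the same
    centralizer ([commute_cent1_eq]). So the commuting graph is a disjoint union
    of [p + 1] cliques of size [m = (p - 1) * |'Z(G)|].

    The spectrum of a disjoint union of [k] cliques of size [m] is then found
    without computing a determinant ([cliques_spectrum]). If [A] is the adjacency
    matrix, [B = A + 1] satisfies [B ^ 2 = m B], so the only possible eigenvalues
    are [-1] and [m - 1]; that there are [k * m] of them and that they add up to
    the trace, which is [0], fixes both multiplicities. *)

(** * Covering a group by few subgroups of large index *)

Local Open Scope nat_scope.

(** Double counting: the right-hand side counts each [x] outside [H] once for
    every member of the cover that contains it. The equality case is kept
    because it says that two members other than [H] are disjoint outside [H]. *)
Lemma cover_diff_leqif (gT : finGroupType) (G H : {group gT})
    (S : {set {group gT}}) :
    {in S, forall K : {group gT}, K \subset G} ->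
    G \subset \bigcup_(K in S) K -> 
  #|G :\: H| <= \sum_(K in S :\ H) #|K :\: H|
    ?= iff [forall (x | x \in G :\: H), 1 == #|[set K in S :\ H | x \in K]|].
Proof.
move=> sSG /subsetP covG.
have ->: (\sum_(K in S :\ H) #|K :\: H|
          = \sum_(x in G :\: H) #|[set K in S :\ H | x \in K]|)%N.
  under eq_bigr => K SK.
    rewrite -sum1_card.
    have ->: (\sum_(x in K :\: H) 1 = \sum_(x in G :\: H) (x \in K))%N.
      rewrite [RHS]big_mkcond [LHS]big_mkcond /=; apply: eq_bigr => x _.
      have /subsetP/(_ x) sKG: K \subset G by apply: sSG; case/setD1P: SK.
      rewrite !inE; case: (x \in H); case: (x \in K) sKG => //= [->|] //.
      by case: (x \in G).
    over.
  rewrite exchange_big /=; apply: eq_bigr => x _.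
  rewrite -sum1_card [RHS]big_mkcond [LHS]big_mkcond /=; apply: eq_bigr => K _.
  by rewrite !inE; case: (_ && _) => //; case: (x \in K).
rewrite -sum1_card; apply: leqif_sum => x /setDP[Gx nHx]; split => //.
rewrite card_gt0; apply/set0Pn.
have /bigcupP[K SK Kx] := covG x Gx.
by exists K; rewrite !inE SK Kx !andbT; apply: contraNneq nHx => <-.
Qed.

(** The product formula bounds [K :&: H] from below, so [K] has at most as large
    a proportion of its elements outside [H] as [G] has. *)
Lemma card_diff_leq (gT : finGroupType) (G H K : {group gT}) :
  H \subset G -> K \subset G ->
  (#|K :\: H| * #|G| <= #|K| * #|G :\: H|)%N.
Proof.
move=> sHG sKG; rewrite cardsD (cardsD G H) (setIidPr sHG).
have := mul_cardG H K.
have : (#|(H * K)%g| <= #|G|)%N by rewrite subset_leq_card ?mul_subG.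
have := subset_leq_card (subsetIl K H); have := subset_leq_card sHG.
rewrite (setIC H); move: #|_ :&: _| #|(H * K)%g| => i u; nia.
Qed.

Section MinimalCover.

Variables (gT : finGroupType) (G : {group gT}) (S : {set {group gT}}) (p : nat).
Hypotheses (p_gt1 : 1 < p) (cardS : #|S| <= p.+1).
Hypothesis sSG : {in S, forall H : {group gT}, H \subset G}.
Hypothesis indexS : {in S, forall H : {group gT}, p <= #|G : H|%g}.
Hypothesis covG : G \subset \bigcup_(H in S) H.

Let index_le (H : {group gT}) : H \in S -> (p * #|H| <= #|G|)%N.
Proof.
by move=> SH; rewrite -(Lagrange (sSG SH)) mulnC leq_mul2l indexS ?orbT.
Qed.

Let diff_gt0 (H : {group gT}) : H \in S -> 0 < #|G :\: H|.
Proof.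
move=> SH; rewrite cardsD (setIidPr (sSG SH)).
have := index_le SH; have := cardG_gt0 H; nia.
Qed.

Let cardS1 (H : {group gT}) : H \in S -> #|S :\ H| <= p.
Proof. by move=> SH; move: cardS; rewrite (cardsD1 H) SH. Qed.

(* Every member loses at least the proportion [|H| / |G|] of its elements to
   [H]; what is left still has to cover [G :\: H]. *)
Let cover_sum (H : {group gT}) : H \in S -> #|G| <= \sum_(K in S :\ H) #|K|.
Proof.
move=> SH; rewrite -(leq_pmul2r (diff_gt0 SH)) big_distrl /=.
apply: leq_trans (_ : #|G| * \sum_(K in S :\ H) #|K :\: H| <= _)%N.
  by rewrite leq_mul2l (cover_diff_leqif H sSG covG) orbT.
rewrite big_distrr /=; apply: leq_sum => K /setD1P[_ SK].
by rewrite mulnC card_diff_leq ?sSG.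
Qed.

(** The at most [p] members other than a fixed [H], each of order at most
    [|G| / p], have orders summing to at least [|G|], so each bound is attained.
    Any [H] distinct from [K] will do; one exists since [K] alone does not
    cover [G]. *)
Lemma cover_index (K : {group gT}) : K \in S -> (p * #|K| = #|G|)%N.
Proof.
move=> SK.
have /set0Pn[H /setD1P[neHK SH]]: S :\ K != set0.
  apply: contraTneq (cover_sum SK) => ->; rewrite big_set0.
  by have := cardG_gt0 G; lia.
have S'K: K \in S :\ H by rewrite !inE eq_sym neHK.
have le_pG: {in S :\ H, forall L : {group gT}, p * #|L| <= #|G|}%N.
  by move=> L /setD1P[_ /index_le].
have [_] := leqif_sum (fun L S'L => leqif_eq (le_pG L S'L)).
rewrite -big_distrr sum_nat_const /= eqn_leq.
have ->: (#|S :\ H| * #|G| <= p * \sum_(L in S :\ H) #|L|)%N.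
  by rewrite leq_mul ?cardS1 ?cover_sum.
rewrite andbT.
have -> : (p * \sum_(L in S :\ H) #|L| <= #|S :\ H| * #|G|)%N.
  by rewrite -sum_nat_const big_distrr leq_sum.
by move/esym/forall_inP/(_ K S'K)/eqP.
Qed.

Let diff_le (H K : {group gT}) : H \in S -> K \in S ->
  (p * #|K :\: H| <= #|G :\: H|)%N.
Proof.
move=> SH SK; rewrite -(leq_pmul2l (cardG_gt0 K)) mulnCA mulnA.
rewrite (cover_index SK) mulnC.
exact: card_diff_leq (sSG SH) (sSG SK).
Qed.

Let diff_sum (H : {group gT}) : H \in S ->
  (\sum_(K in S :\ H) p * #|K :\: H| <= p * #|G :\: H|)%N.
Proof.
move=> SH; apply: leq_trans (_ : \sum_(K in S :\ H) #|G :\: H| <= _)%N.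
  by apply: leq_sum => K /setD1P[_ SK]; apply: diff_le.
by rewrite sum_nat_const leq_mul2r cardS1 ?orbT.
Qed.

(** The members other than [H] have at most [|G :\: H|] elements outside [H]
    altogether, so they cover each element of [G :\: H] exactly once. *)
Lemma cover_cap_sub (H K L : {group gT}) :
  H \in S -> K \in S -> L \in S -> K != L -> K :&: L \subset H.
Proof.
move=> SH SK SL neKL; apply/subsetP=> x /setIP[Kx Lx].
apply: contraNT neKL => nHx.
have [le_sum] := cover_diff_leqif H sSG covG.
have := diff_sum SH; rewrite -big_distrr leq_pmul2l ?(ltnW p_gt1) //= => ge_sum.
rewrite eqn_leq le_sum ge_sum => /esym/forall_inP/(_ x).
rewrite inE nHx (subsetP (sSG SK)) // => /(_ isT); rewrite eq_sym.
case/cards1P=> M defM.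
have inM (N : {group gT}) : N \in S -> x \in N -> N = M.
  move=> SN Nx; apply/set1P; rewrite -defM !inE SN Nx !andbT.
  by apply: contraNneq nHx => <-.
by rewrite (inM K) // (inM L).
Qed.

(** Each of the at most [p] members other than [H] covers at most
    [|G :\: H| / p] elements of [G :\: H], so it covers exactly that many. *)
Lemma cover_card_cap (H K : {group gT}) :
  H \in S -> K \in S -> H != K -> (p ^ 2 * #|H :&: K| = #|G|)%N.
Proof.
move=> SH SK neHK.
have S'K: K \in S :\ H by rewrite !inE eq_sym neHK.
have le_d: {in S :\ H, forall L : {group gT}, p * #|L :\: H| <= #|G :\: H|}%N.
  by move=> L /setD1P[_ SL]; apply: diff_le.
have [_] := leqif_sum (fun L S'L => leqif_eq (le_d L S'L)).
rewrite eqn_leq leq_sum //= sum_nat_const -big_distrr /=.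
rewrite leq_mul ?cardS1 ?(cover_diff_leqif H sSG covG) //.
move/esym/forall_inP/(_ K S'K)/eqP.
have := cardsID H G; rewrite (setIidPr (sSG SH)) => eqG eqKH.
have eqHK: (p * #|H :&: K| + p * #|K :\: H| = p * #|K|)%N.
  by rewrite -mulnDr setIC cardsID.
rewrite -mulnn -mulnA -(cover_index SH); congr (p * _)%N.
apply/eqP; rewrite -(eqn_add2r (p * #|K :\: H|)) eqHK eqKH eqG.
by rewrite (cover_index SK).
Qed.

End MinimalCover.

(** * The spectrum of a disjoint union of equal cliques *)

Local Open Scope ring_scope.

Lemma size_spectrum (T : finType) (e : rel T) : size (spectrum e) = #|T|.
Proof.
apply/eqP; rewrite -eqSS -(size_char_poly (adj_mx e)) spectrumP.
by rewrite size_prod_XsubC.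
Qed.

Lemma spectrum_eigenvalue (T : finType) (e : rel T) :
  spectrum e =i eigenvalue (adj_mx e).
Proof.
by move=> a; rewrite [RHS]eigenvalue_root_char spectrumP root_prod_XsubC.
Qed.

Lemma sum_spectrum (T : finType) (e : rel T) :
  \sum_(a <- spectrum e) a = \tr (adj_mx e).
Proof.
have [T0|T_gt0] := posnP #|T|.
  have /size0nil-> : size (spectrum e) = 0%N by rewrite size_spectrum.
  rewrite big_nil /mxtrace big1 // => i _.
  by have := ltn_ord i; rewrite [X in (_ < X)%N]T0.
apply: oppr_inj; rewrite -char_poly_trace // spectrumP.
by rewrite -coefPn_prod_XsubC size_spectrum // -lt0n.
Qed.

Lemma perm_two_values (T : eqType) (a b : T) (s : seq T) :
  {in s, forall x, x = a \/ x = b} ->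
  exists i j, perm_eq s (nseq i a ++ nseq j b).
Proof.
elim: s => [|x s IHs] sab; first by exists 0%N, 0%N.
have [|i [j sij]] := IHs; first by move=> y sy; apply: sab; rewrite inE sy orbT.
case: (sab x (mem_head x s)) => ->.
  by exists i.+1, j; rewrite /= perm_cons.
exists i, j.+1; apply: (@perm_trans _ (b :: nseq i a ++ nseq j b)).
  by rewrite perm_cons.
by rewrite -cat1s perm_catCA.
Qed.

Section DisjointCliques.

Variables (T : finType) (r : rel T) (m k : nat).
Hypothesis r_equiv : equivalence_rel r.
Hypothesis m_gt0 : (0 < m)%N.
Hypothesis card_class : forall x, #|[set y | r x y]| = m.
Hypothesis cardT : #|T| = (k * m)%N.

Let e : rel T := fun x y => (x != y) && r x y.
Let A := adj_mx e.

(** [A + 1] is the matrix of [r], so an entry of its square counts the paths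
    [r x y], [r y z]; by transitivity these are the members of the class of [x]
    when [r x z] holds, and there are none otherwise. *)
Lemma cliques_sqr_mx : (A + 1%:M) *m (A + 1%:M) = m%:R *: (A + 1%:M).
Proof.
have [rxx rsym rtrans] : [/\ reflexive r, symmetric r & transitive r].
  by have /equivalence_relP[rr rlr] := r_equiv; split=> // [x y|y x z];
   [apply/idP/idP => /rlr <-; rewrite rr | move=> /rlr->].
have defB i j : (A + 1%:M) i j = (r (enum_val i) (enum_val j))%:R.
  rewrite !mxE /e (inj_eq enum_val_inj).
  by case: eqVneq => [->|_]; rewrite ?rxx ?add0r ?addr0.
apply/matrixP=> i j; rewrite [LHS]mxE [RHS]mxE defB.
under eq_bigr => l _ do rewrite !defB -natrM mulnb.
rewrite -natr_sum -natrM; congr (_%:R).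
set x := enum_val i; set z := enum_val j.
transitivity (\sum_(y : T) (r x y && r y z))%N.
  by rewrite (reindex (@enum_val T xpredT)) //; exact/onW_bij/enum_val_bij.
rewrite -(card_class x) -sum1_card big_distrl /= [RHS]big_mkcond /=.
apply: eq_bigr => y _; rewrite inE mul1n; case rxy: (r x y) => //=.
by have /equivalence_relP[_ /(_ _ _ rxy)->] := r_equiv.
Qed.

Lemma cliques_eigenvalue a : a \in spectrum e -> a = -1 \/ a = m%:R - 1.
Proof.
rewrite spectrum_eigenvalue => /eigenvalueP[v vA nz_v].
have vB : v *m (A + 1%:M) = (a + 1) *: v.
  by rewrite mulmxDr vA mulmx1 scalerDl scale1r.
have : (a + 1) * (a + 1 - m%:R) == 0.
  have : v *m ((A + 1%:M) *m (A + 1%:M)) = v *m (m%:R *: (A + 1%:M)).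
    by rewrite cliques_sqr_mx.
  rewrite mulmxA vB -scalemxAl vB -scalemxAr vB !scalerA => /eqP.
  rewrite -subr_eq0 -scalerBl scaler_eq0 (negPf nz_v) orbF.
  by rewrite mulrBr [m%:R * _]mulrC.
rewrite mulf_eq0 addr_eq0 subr_eq0 => /orP[] /eqP; first by left.
by move=> <-; right; rewrite addrK.
Qed.

(** With [i] eigenvalues [-1] and [j] eigenvalues [m - 1], the size and the trace
    give [i + j = k * m] and [(m - 1) * j = i], whence [j = k]. *)
Theorem cliques_spectrum :
  perm_eq (spectrum e) (nseq (k * m - k) (-1) ++ nseq k (m%:R - 1)).
Proof.
have [i [j sij]] := perm_two_values cliques_eigenvalue.
have size_ij : (i + j = k * m)%N.
  by rewrite -cardT -(size_spectrum e) (perm_size sij) size_cat !size_nseq.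
have tr0 : \sum_(a <- spectrum e) a = 0.
  by rewrite sum_spectrum /mxtrace big1 // => l _; rewrite mxE /e eqxx.
move: tr0; rewrite (perm_big _ sij) big_cat !big_nseq /= !iter_addr_0.
rewrite -[_ *+ i]mulr_natr -[_ *+ j]mulr_natr => tr0.
have : ((j * m)%:R == (i + j)%:R :> algC).
  by rewrite -subr_eq0 natrM natrD -tr0; apply/eqP; ring.
rewrite size_ij eqr_nat eqn_pmul2r // => /eqP jk.
by rewrite -jk -[X in nseq (X - _)](_ : i + j = _)%N ?addnK // size_ij jk.
Qed.

End DisjointCliques.

(** * Groups of prime-power order with few centralizers *)

Lemma cent1_full_centerP (gT : finGroupType) (G : {group gT}) (x : gT) :
  x \in G -> reflect ('C_G[x] = G)%g (x \in 'Z(G))%g.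
Proof.
move=> Gx; apply: (iffP idP) => [/setIP[_ /centP cGx]|CxG].
  by apply/setIidPl/subsetP=> y Gy; apply/cent1P/commute_sym/cGx.
apply/setIP; split=> //; apply/centP=> y Gy.
by move: Gy; rewrite -{1}CxG => /setIP[_ /cent1P].
Qed.

Lemma center_sub_cent1 (gT : finGroupType) (G : {group gT}) (x : gT) :
  x \in G -> 'Z(G)%g \subset 'C_G[x]%g.
Proof. by move=> Gx; apply: setIS; rewrite -cent_set1 centS ?sub1set. Qed.

Section FewCentralizers.

Variables (gT : finGroupType) (G : {group gT}) (p : nat).
Hypotheses (p_pr : prime p) (pG : (p.-group G)%g).
Hypothesis centG : n_centralizer (p + 2) G.

Let S : {set {group gT}} := [set 'C_G[x]%G | x in G :\: 'Z(G)%g].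

Lemma few_centralizers_nonabelian : ~~ abelian G.
Proof.
apply/negP=> abG; move: centG; rewrite /n_centralizer.
suff ->: Cent G = [set (G : {set gT})] by rewrite cards1; lia.
apply/setP=> C; rewrite inE; apply/imsetP/eqP => [[x Gx ->]|->].
  by apply/(cent1_full_centerP Gx); rewrite (center_idP abG).
exists 1%g => //; apply/esym/(cent1_full_centerP (group1 G)).
exact: group1.
Qed.

(* [Cent G] also contains [G] itself, the centralizer of the identity. *)
Let card_S : #|S| = p.+1.
Proof.
have defC : Cent G :\ (G : {set gT}) = [set gval H | H in S].
  apply/setP=> C; apply/setD1P/imsetP => [[neCG /imsetP[x Gx defC]]|].
    exists 'C_G[x]%G => //; apply/imsetP; exists x => //.
    rewrite inE Gx andbT; apply: contra neCG => /(cent1_full_centerP Gx) CxG.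
    by rewrite defC CxG.
  case=> _ /imsetP[x /setDP[Gx nZx] ->] -> /=; split; last exact: imset_f.
  by apply: contra nZx => /eqP/(cent1_full_centerP Gx).
have GC : (G : {set gT}) \in Cent G.
  apply/imsetP; exists 1%g => //; apply/esym/(cent1_full_centerP (group1 G)).
  exact: group1.
have := cardsD1 (G : {set gT}) (Cent G).
rewrite centG GC defC card_imset; last exact: group_inj.
by move: #|S| => s; lia.
Qed.

Let sSG : {in S, forall H : {group gT}, H \subset G}.
Proof. by move=> _ /imsetP[x _ ->]; apply: subsetIl. Qed.

Let in_S x : x \in G -> x \notin 'Z(G)%g -> 'C_G[x]%G \in S.
Proof. by move=> Gx nZx; apply/imsetP; exists x; rewrite // inE Gx andbT. Qed.

Let indexS : {in S, forall H : {group gT}, (p <= #|G : H|%g)%N}.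
Proof.
move=> _ /imsetP[x /setDP[Gx nZx] ->] /=.
have [k def_i] := p_natP (pnat_dvd (dvdn_indexg G 'C_G[x]%G) pG).
case: k def_i => [/eqP|k ->].
  rewrite /= expn0 indexg_eq1 => sGC; case/negP: nZx.
  by apply/(cent1_full_centerP Gx)/eqP; rewrite eqEsubset subsetIl.
by rewrite expnS leq_pmulr // expn_gt0 prime_gt0.
Qed.

Let covG : G \subset \bigcup_(H in S) H.
Proof.
apply/subsetP=> x Gx; have [Zx|nZx] := boolP (x \in 'Z(G)%g).
  have /subsetPn[y Gy nZy]: ~~ (G \subset 'Z(G))%g.
    by rewrite subsetI subxx few_centralizers_nonabelian.
  apply/bigcupP; exists 'C_G[y]%G; first exact: in_S.
  rewrite inE Gx; apply/cent1P; case/setIP: Zx => _ /centP; exact.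
by apply/bigcupP; exists 'C_G[x]%G; rewrite ?in_S //= inE Gx cent1id.
Qed.

Let leS : (#|S| <= p.+1)%N. Proof. by rewrite card_S. Qed.
Let p_gt1 : (1 < p)%N := prime_gt1 p_pr.

(** An element of two distinct proper centralizers lies in all of them, hence
    commutes with every noncentral element of [G]. *)
Lemma distinct_cent1_cap (H K : {group gT}) : H \in S -> K \in S -> H != K ->
  H :&: K = 'Z(G)%g.
Proof.
move=> SH SK neHK; apply/eqP; rewrite eqEsubset; apply/andP; split.
  apply/subsetP=> x HKx; apply/setIP.
  have Gx : x \in G by case/setIP: HKx => /(subsetP (sSG SH)).
  split=> //; apply/centP=> y Gy; have [Zy|nZy] := boolP (y \in 'Z(G)%g).
    by case/setIP: Zy => _ /centP/(_ x Gx)/commute_sym.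
  have Sy := in_S Gy nZy.
  have /subsetP/(_ x HKx) :=
    cover_cap_sub p_gt1 leS sSG indexS covG Sy SH SK neHK.
  by case/setIP=> _ /cent1P/commute_sym.
have ZS (L : {group gT}) : L \in S -> ('Z(G) \subset L)%g.
  case/imsetP=> x /setDP[Gx _] ->.
  exact: center_sub_cent1.
by rewrite subsetI !ZS.
Qed.

Lemma card_noncentral_cent1 x :
  x \in G :\: 'Z(G)%g -> #|'C_G[x]%g| = (p * #|'Z(G)%g|)%N.
Proof.
case/setDP=> Gx nZx; have Sx := in_S Gx nZx.
have /set0Pn[K /setD1P[neK SK]]: S :\ 'C_G[x]%G != set0.
  rewrite -card_gt0; have := cardsD1 'C_G[x]%G S; rewrite Sx card_S.
  by rewrite add1n => /succn_inj <-; apply: prime_gt0.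
apply/eqP; rewrite -(eqn_pmul2l (prime_gt0 p_pr)) mulnA mulnn.
rewrite (cover_index p_gt1 leS sSG indexS covG Sx).
rewrite -(distinct_cent1_cap SK Sx neK).
by rewrite (cover_card_cap p_gt1 leS sSG indexS covG SK Sx).
Qed.

Lemma card_few_centralizers : #|G| = (p ^ 2 * #|'Z(G)%g|)%N.
Proof.
have /subsetPn[x Gx nZx]: ~~ (G \subset 'Z(G))%g.
  by rewrite subsetI subxx few_centralizers_nonabelian.
rewrite -(cover_index p_gt1 leS sSG indexS covG (in_S Gx nZx)) /=.
by rewrite card_noncentral_cent1 1?inE ?nZx // mulnA mulnn.
Qed.

(** If [x] and [y] commute, [y] lies in both centralizers; were these distinct,
    [y] would be central. *)
Lemma commute_cent1_eq x y :
  x \in G :\: 'Z(G)%g -> y \in G :\: 'Z(G)%g ->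
  (x * y == y * x)%g = ('C_G[x]%g == 'C_G[y]%g).
Proof.
case/setDP=> Gx nZx /setDP[Gy nZy]; apply/eqP/eqP => [cxy|eqC].
  apply: contraNeq (nZy) => neC.
  rewrite -(distinct_cent1_cap (in_S Gx nZx) (in_S Gy nZy)) //=.
  apply/setIP; split; apply/setIP; split=> //; last exact: cent1id.
  exact/cent1P/commute_sym.
by have /setIP[_ /cent1P]: x \in 'C_G[y]%g by rewrite -eqC inE Gx cent1id.
Qed.

End FewCentralizers.

Theorem corollary2p4 (p : nat) (gT : finGroupType) (G : {group gT})
  (p_pr : prime p) (pG : (p.-group G)%g) (centG : n_centralizer (p + 2) G) :
  perm_eq (spectrum (@commuting_graph gT G))
    (nseq ((p ^ 2 - 1) * #|'Z(G)%g| - p - 1) (-1)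
     ++ nseq (p + 1) ((p%:R - 1) * #|'Z(G)%g|%:R - 1))
  /\ commuting_integral G.
Proof.
pose r (x y : noncentral G) := (val x * val y == val y * val x)%g.
pose m := ((p - 1) * #|'Z(G)%g|)%N.
have p_gt1 := prime_gt1 p_pr.
have sqr_sub1 : (p ^ 2 - 1 = (p + 1) * (p - 1))%N.
  by rewrite mulnC -(subn_sqr p 1).
have card_diffZ (H : {group gT}) : 'Z(G)%g \subset H ->
    #|H :\: 'Z(G)%g| = (#|H| - #|'Z(G)%g|)%N.
  by move=> sZH; rewrite cardsD (setIidPr sZH).
have rE : r =2 fun x y => 'C_G[val x]%g == 'C_G[val y]%g.
  by move=> x y; apply: (commute_cent1_eq p_pr pG centG); apply: valP.
have r_equiv : equivalence_rel r.
  by move=> x y z; rewrite !rE eqxx; split=> // /eqP->.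
have m_gt0 : (0 < m)%N by rewrite muln_gt0 subn_gt0 p_gt1 cardG_gt0.
have card_class x : #|[set y | r x y]| = m.
  have := card_noncentral_cent1 p_pr pG centG (valP x) => cardC.
  have sZC : 'Z(G)%g \subset 'C_G[val x]%G.
    have /setDP[Gx _] := valP x.
    exact: center_sub_cent1.
  rewrite /m mulnBl mul1n -cardC -card_diffZ //.
  rewrite -(card_imset _ val_inj); congr #|pred_of_set _|; apply/setP=> y.
  apply/imsetP/setDP => [[z]|[/setIP[Gy /cent1P cxy] nZy]].
    rewrite inE => /eqP cxz -> {y}; have /setDP[Gz nZz] := valP z.
    by split=> //; rewrite inE Gz; apply/cent1P/commute_sym.
  have GZy : y \in G :\: 'Z(G)%g by rewrite inE nZy.
  by exists (Sub y GZy); rewrite // inE /r /= eq_sym; apply/eqP.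
have cardT : #|noncentral G| = ((p + 1) * m)%N.
  rewrite card_sig card_diffZ ?center_sub // mulnA.
  by rewrite -sqr_sub1 (card_few_centralizers p_pr pG centG) mulnBl mul1n.
have spec := cliques_spectrum r_equiv m_gt0 card_class cardT.
have -> : ((p ^ 2 - 1) * #|'Z(G)%g| - p - 1 = (p + 1) * m - (p + 1))%N.
  by rewrite -subnDA sqr_sub1 mulnA.
have -> : (p%:R - 1) * #|'Z(G)%g|%:R = m%:R :> algC.
  by rewrite /m natrM natrB // ltnW.
split=> //; split; first exact: few_centralizers_nonabelian centG.
move=> a; rewrite (perm_mem spec) mem_cat !mem_nseq.
by case/orP=> /andP[_ /eqP->]; rewrite ?rpredB ?rpredN ?rpred1 ?rpred_nat.
Qed.
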